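(* Let $A\in\mathbb{Z}^{d\times n}$ be an integer matrix with columns $a_1,\dots,a_n$ such that there exists $c\in\mathbb{Q}^d$ with $c\cdot a_i>0$ for $i=1,\dots,n$. Let $H$ be the set of holes and $H_0=\{y_1,\dots,y_m\}$ the (finite) set of fundamental holes of the semigroup generated by $a_1,\dots,a_n$, and let $\bar\lambda_{hi}$ be as defined in the context. Then $H$ is finite if and only if $\bar\lambda_{hi}<\infty$ for all $h=1,\dots,m$ and all $i=1,\dots,n$.
   Context: $\mathbb{N}=\{0,1,2,\dots\}$. $Q=\{\sum_{i=1}^n x_i a_i : x_i\in\mathbb{N}\}$, $K=\{\sum_{i=1}^n x_i a_i: x_i\in\mathbb{R}_{\ge 0}\}$, $L=\{\sum_{i=1}^n x_i a_i: x_i\in\mathbb{Z}\}$, and $Q_{\rm sat}=K\cap L$. The set of holes is $H=Q_{\rm sat}\setminus Q$. A fundamental hole is an element $a\in Q_{\rm sat}$, $a\neq 0$, such that $Q_{\rm sat}\cap\{a-q: q\in Q\}=\{a\}$; $H_0$ is the set of fundamental holes. It is a finite set, written $H_0=\{y_1,\dots,y_m\}$, and every fundamental hole is a hole. For each $h\in\{1,\dots,m\}$ and $i\in\{1,\dots,n\}$ define $\bar\lambda_{hi}=\min\{\lambda\in\mathbb{Z}: y_h+\lambda a_i\in Q\}$ if there is some $\lambda\in\mathbb{Z}$ with $y_h+\lambda a_i\in Q$, and $\bar\lambda_{hi}=\infty$ otherwise. *)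

(* Defs.v *)
From HB Require Import structures.
From mathcomp Require Import all_boot all_order all_algebra.
From mathcomp Require Import all_classical all_reals.

Set Implicit Arguments.
Unset Strict Implicit.
Unset Printing Implicit Defensive.

Import Order.TTheory GRing.Theory Num.Theory.
Local Open Scope classical_set_scope.
Local Open Scope ring_scope.

Definition semigroup (d n : nat) (A : 'M[int]_(d, n)) : set 'cV[int]_d :=
  [set v | exists x : 'I_n -> nat, v = \sum_(i < n) col i A *+ x i].

Definition lattice (d n : nat) (A : 'M[int]_(d, n)) : set 'cV[int]_d :=
  [set v | exists x : 'I_n -> int, v = \sum_(i < n) col i A *~ x i].

Definition cone (R : realType) (d n : nat) (A : 'M[int]_(d, n)) :
    set 'cV[R]_d :=
  [set v | exists x : 'I_n -> R, (forall i, 0 <= x i) /\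
     v = \sum_(i < n) x i *: map_mx intr (col i A)].

Definition saturation (R : realType) (d n : nat) (A : 'M[int]_(d, n)) :
    set 'cV[int]_d :=
  [set v | cone A (map_mx intr v : 'cV[R]_d)] `&` lattice A.

Definition holes (R : realType) (d n : nat) (A : 'M[int]_(d, n)) :
    set 'cV[int]_d :=
  saturation R A `\` semigroup A.

Definition fundamental_holes (R : realType) (d n : nat) (A : 'M[int]_(d, n)) :
    set 'cV[int]_d :=
  [set a | [/\ saturation R A a, a != 0 &
     saturation R A `&` [set a - q | q in semigroup A] = [set a]]].

Definition shifts (d n : nat) (A : 'M[int]_(d, n)) (y : 'cV[int]_d)
    (i : 'I_n) : set int :=
  [set l | semigroup A (y + col i A *~ l)].

Definition is_min (S : set int) (l : int) : Prop :=
  S l /\ forall k, S k -> l <= k.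

(* The default value 0 of [xget] is irrelevant when the columns of A lie in an
   open half-space: [shifts A y i] is then bounded below, so that it has a
   minimum, which is unique, as soon as it is nonempty. *)
Definition lambda_bar (d n : nat) (A : 'M[int]_(d, n)) (y : 'cV[int]_d)
    (i : 'I_n) : \bar int :=
  if `[< exists l, shifts A y i l >]
  then (xget 0 [set l | is_min (shifts A y i) l])%:E
  else +oo%E.

(* Main.v *)
(* Subtracting semigroup elements from a hole as long as the result stays in the
   saturation ends at a fundamental hole, so every hole is [y + sum_i x_i a_i]
   with [y] fundamental; there are finitely many such [y], as they lie in the
   zonotope of the columns. If some [y + k a_i] is in the semigroup then
   [x_i < k], which leaves finitely many holes over [y]; otherwise all
   [y + k a_i] with [k : nat] are holes. *)
Require Import Defs.
From HB Require Import structures.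
From mathcomp Require Import all_boot all_order all_algebra.
From mathcomp Require Import all_classical all_reals.
From mathcomp Require Import zify.

Set Implicit Arguments.
Unset Strict Implicit.
Unset Printing Implicit Defensive.

Import Order.TTheory GRing.Theory Num.Theory.
Local Open Scope classical_set_scope.
Local Open Scope ring_scope.

Lemma semigroup0 (d n : nat) (A : 'M[int]_(d, n)) : semigroup A 0.
Proof. by exists (fun=> 0%N); rewrite big1. Qed.

Lemma semigroupD (d n : nat) (A : 'M[int]_(d, n)) (u v : 'cV[int]_d) :
  semigroup A u -> semigroup A v -> semigroup A (u + v).
Proof.
move=> [x ->] [y ->]; exists (fun i => x i + y i)%N.
by rewrite -big_split; apply: eq_bigr => i _; rewrite mulrnDr.
Qed.

Lemma semigroupMn (d n : nat) (A : 'M[int]_(d, n)) (i : 'I_n) (k : nat) :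
  semigroup A (col i A *+ k).
Proof.
exists (fun j => if j == i then k else 0%N).
rewrite (bigD1 i) //= eqxx big1 ?addr0 // => j /negPf ->.
by rewrite mulr0n.
Qed.

Lemma coneD (R : realType) (d n : nat) (A : 'M[int]_(d, n)) (u v : 'cV[R]_d) :
  cone A u -> cone A v -> cone A (u + v).
Proof.
move=> [x [x0 ->]] [y [y0 ->]]; exists (fun i => x i + y i); split.
  by move=> i; rewrite addr_ge0.
by rewrite -big_split; apply: eq_bigr => i _; rewrite scalerDl.
Qed.

Lemma latticeB (d n : nat) (A : 'M[int]_(d, n)) (u v : 'cV[int]_d) :
  lattice A u -> lattice A v -> lattice A (u - v).
Proof.
move=> [x ->] [y ->]; exists (fun i => x i - y i).
by rewrite -sumrB; apply: eq_bigr => i _; rewrite mulrzBr.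
Qed.

Lemma semigroup_lattice (d n : nat) (A : 'M[int]_(d, n)) :
  semigroup A `<=` lattice A.
Proof. by move=> v [x ->]; exists (fun i => (x i)%:Z). Qed.

Lemma semigroup_saturation (R : realType) (d n : nat) (A : 'M[int]_(d, n)) :
  semigroup A `<=` saturation R A.
Proof.
move=> v Qv; split; last exact: semigroup_lattice.
case: Qv => x ->; exists (fun i => (x i)%:R); split=> //.
rewrite /= raddf_sum; apply: eq_bigr => i _.
by rewrite raddfMn scaler_nat.
Qed.

Lemma saturationD (R : realType) (d n : nat) (A : 'M[int]_(d, n))
    (u v : 'cV[int]_d) :
  saturation R A u -> saturation R A v -> saturation R A (u + v).
Proof.
move=> [Ku [x ux]] [Kv [y vy]]; split.
  by rewrite /= map_mxD; exact: coneD Ku Kv.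
rewrite ux vy; exists (fun i => x i + y i).
by rewrite -big_split; apply: eq_bigr => i _; rewrite mulrzDr.
Qed.

(** The working form of fundamentality: the point [y - q] lies in the intersection of the
    definition, hence equals [y]. *)
Lemma fundamental_hole_sub (R : realType) (d n : nat) (A : 'M[int]_(d, n))
    (y q : 'cV[int]_d) :
  fundamental_holes R A y -> semigroup A q -> saturation R A (y - q) -> q = 0.
Proof.
move=> [_ _ yP] Qq Sq.
have : [set y] (y - q) by rewrite -yP; split=> //; exists q.
by move=> /= yq; rewrite -[LHS](subKr y) yq subrr.
Qed.

(** If [y] were in the semigroup, [q = y] could be subtracted, leaving 0 in the saturation and
    forcing [y = 0]. *)
Lemma fundamental_hole_hole (R : realType) (d n : nat) (A : 'M[int]_(d, n)) :
  fundamental_holes R A `<=` holes R A.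
Proof.
move=> y yF; have [Sy y0 _] := yF; split=> // Qy.
move/eqP: y0; apply; apply: (fundamental_hole_sub yF Qy).
by rewrite subrr; apply/semigroup_saturation/semigroup0.
Qed.

Lemma finite_bounded_int_cV (d : nat) (B : 'I_d -> int) :
  finite_set [set v : 'cV[int]_d | forall j, `|v j 0| <= B j].
Proof.
(* All entries lie in [[-N, N]]; shifting by [N] codes them by the [2N + 1] ordinals. *)
pose N := \max_(j < d) `|B j|%N.
pose f (g : {ffun 'I_d -> 'I_(N + N).+1}) : 'cV[int]_d :=
  \col_j ((g j)%:Z - N%:Z).
apply: (@sub_finite_set _ _ (range f)); last exact: finite_image.
move=> v /= vB.
have vN j : `|v j 0| <= N%:Z.
  apply: (le_trans (vB j)); apply: (le_trans (ler_norm _)).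
  by rewrite -abszE lez_nat; apply: (leq_bigmax j).
have vg j : (`|(v j 0 + N%:Z)%R| < (N + N).+1)%N by have := vN j; lia.
exists [ffun j => Ordinal (vg j)] => //.
apply/matrixP => j k; rewrite (ord1 k) !mxE ffunE /=.
by have := vN j; lia.
Qed.

(* Writing [y] in the cone with coefficients [x], a coefficient [x i >= 1] would
   leave [y - a_i] in the saturation; so [y] lies in the zonotope of the
   columns. *)
Lemma finite_fundamental_holes (R : realType) (d n : nat)
    (A : 'M[int]_(d, n)) (a_neq0 : forall i, col i A != 0) :
  finite_set (fundamental_holes R A).
Proof.
apply: sub_finite_set (finite_bounded_int_cV (fun j => \sum_i `|A j i|)).
move=> y yF /= j; have [[[x [x0 yx]] Ly] _ _] := yF.
have x1 i : x i <= 1.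
  rewrite leNgt; apply/negP => xi1; move/eqP: (a_neq0 i); apply.
  apply: (fundamental_hole_sub yF); first exact: (semigroupMn A i 1).
  split; last by apply/latticeB/semigroup_lattice/(semigroupMn A i 1).
  exists (fun k => x k - (k == i)%:R); split.
    move=> k; case: eqP => [->|_]; last by rewrite subr0.
    by rewrite subr_ge0 ltW.
  rewrite map_mxB yx; under [RHS]eq_bigr do rewrite scalerBl.
  rewrite sumrB; congr (_ - _).
  rewrite (bigD1 i) //= eqxx scale1r big1 ?addr0 // => k /negPf ->.
  by rewrite scale0r.
(* With [0 <= x i <= 1], the triangle inequality bounds each coordinate; it is applied over [R],
   where the [x i] live. *)
have := congr1 (fun v : 'cV[R]_d => v j 0) yx; rewrite mxE summxE => yj.
rewrite -(ler_int R) intr_norm yj raddf_sum.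
apply: (le_trans (ler_norm_sum _ _ _)); apply: ler_sum => i _.
rewrite /= !mxE normrM (ger0_norm (x0 i)) intr_norm.
by rewrite ler_piMl.
Qed.

(* Each removal of a nonzero semigroup element lowers the weight [c . v], which
   is nonnegative on the cone, by at least [min_i c . a_i]. *)
Lemma hole_decomposition (R : realType) (d n : nat) (A : 'M[int]_(d, n))
    (c : 'cV[rat]_d)
    (c_gt0 : forall i : 'I_n, 0 < \sum_(j < d) c j 0 * (A j i)%:~R)
    (h : 'cV[int]_d) :
  holes R A h ->
  exists y, fundamental_holes R A y /\ semigroup A (h - y).
Proof.
pose w (v : 'cV[R]_d) : R := \sum_(j < d) ratr (c j 0) * v j 0.
have wB u v : w (u - v) = w u - w v.
  by rewrite -sumrB; apply: eq_bigr => j _; rewrite !mxE mulrBr.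
have w_lin (x : 'I_n -> R) (u : 'I_n -> 'cV[R]_d) :
    w (\sum_i x i *: u i) = \sum_i x i * w (u i).
  under [RHS]eq_bigr do rewrite mulr_sumr.
  rewrite exchange_big; apply: eq_bigr => j _ /=.
  rewrite summxE mulr_sumr; apply: eq_bigr => i _.
  by rewrite !mxE mulrCA.
pose a i : 'cV[R]_d := map_mx intr (col i A).
have wa i : 0 < w (a i).
  have -> : w (a i) = ratr (\sum_(j < d) c j 0 * (A j i)%:~R).
    rewrite raddf_sum; apply: eq_bigr => j _.
    by rewrite !mxE /= rmorphM /= ratr_int.
  by rewrite ltr0q.
(* The seed 1 keeps [e] positive even when there are no columns. *)
pose e : R := \big[Order.min/1]_i w (a i).
have e_gt0 : 0 < e by apply: lt_bigmin.
have e_le i : e <= w (a i) by exact: bigmin_le_cond.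
(* [N] bounds the number of removals and carries the induction; at [N = 0] the weight would be
   negative on the cone. *)
have [N] : exists N : nat, w (map_mx intr h) < N%:R * e.
  exists (Num.bound `|w (map_mx intr h) / e|).
  rewrite -ltr_pdivrMr //; apply: (le_lt_trans (ler_norm _)).
  exact: archi_boundP.
elim: N h => [|N IHN] h hN hH; have [[Kh Lh] nQh] := hH.
  have [x [x0 xE]] := Kh; move: hN; rewrite mul0r xE w_lin ltNge sumr_ge0 //.
  by move=> i _; apply: mulr_ge0 => //; exact: ltW (wa i).
have h0 : h != 0 by apply/eqP => h0; apply: nQh; rewrite h0; exact: semigroup0.
have [hF|nF] := pselect (fundamental_holes R A h).
  by exists h; split=> //; rewrite subrr; exact: semigroup0.
(* As [h] is a nonzero point of the saturation, it can only fail to be fundamental through a second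
   point [h - q] of the intersection. *)
have [q [Qq q0 Sq]] :
    exists q, [/\ semigroup A q, q != 0 & saturation R A (h - q)].
  apply: contrapT => nq; apply: nF; split=> //.
  apply/seteqP; split=> [v [Sv [q Qq qv]] /=|_ -> /=]; last first.
    by split=> //; exists 0; rewrite ?subr0 //; exact: semigroup0.
  have [q0|q0] := eqVneq q 0; first by rewrite -qv q0 subr0.
  by case: nq; exists q; rewrite qv.
have eq : e <= w (map_mx intr q).
  case: Qq q0 {Sq} => x -> q0.
  (* One column used by [q] already contributes weight [e]; the others contribute nonnegatively. *)
  have [i xi] : exists i, (0 < x i)%N.
    apply: contrapT => nx; move/eqP: q0; apply; apply: big1 => i _.
    by case xi: (x i) => [|k] //; case: nx; exists i; rewrite xi.
  have -> : map_mx intr (\sum_i col i A *+ x i) = \sum_i (x i)%:R *: a i.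
    by rewrite raddf_sum; apply: eq_bigr => k _; rewrite raddfMn scaler_nat.
  rewrite w_lin (bigD1 i) //= -[e]addr0 lerD //.
    by apply: (le_trans (e_le i)); rewrite ler_peMl ?ler1n // ltW.
  by apply: sumr_ge0 => k _; rewrite mulr_ge0 // ltW.
have [||y [yF Qy]] := IHN (h - q).
- rewrite map_mxB wB ltrBlDr; apply: (lt_le_trans hN).
  by rewrite -natr1 mulrDl mul1r lerD2l.
- by split=> // Qhq; apply: nQh; rewrite -(subrK q h); exact: semigroupD.
by exists y; split=> //; rewrite -(subrK q h) addrAC; exact: semigroupD.
Qed.

(** Finiteness only asks for some integer shift [l]; adding [|l| - l >= 0] further copies of the
    column makes the shift natural. *)
Lemma lambda_bar_lty (d n : nat) (A : 'M[int]_(d, n)) (y : 'cV[int]_d)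
    (i : 'I_n) :
  (lambda_bar A y i < +oo)%E <-> exists k : nat, semigroup A (y + col i A *+ k).
Proof.
rewrite /lambda_bar; case: asboolP => [[l Ql]|nQ].
  split=> [_|_]; last exact: ltry.
  exists `|l|%N.
  have -> : y + col i A *+ `|l|%N =
            y + col i A *~ l + col i A *+ `|(`|l|%N%:Z - l)%R|%N.
    rewrite -addrA !pmulrn -mulrzDr; congr (_ + _ *~ _); lia.
  exact/semigroupD/semigroupMn.
by split=> [|[k Qk]]; [rewrite ltxx | case: nQ; exists k%:Z].
Qed.

Theorem theorem3p3 (R : realType) (d n : nat) (A : 'M[int]_(d, n))
    (hA : exists c : 'cV[rat]_d,
       forall i : 'I_n, 0 < \sum_(j < d) c j 0 * (A j i)%:~R) :
  finite_set (holes R A) <->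
  (forall y : 'cV[int]_d, fundamental_holes R A y ->
     forall i : 'I_n, (lambda_bar A y i < +oo)%E).
Proof.
have [c c_gt0] := hA.
have a_neq0 i : col i A != 0.
  apply/eqP => ai0; have := c_gt0 i; rewrite big1 ?ltxx // => j _.
  by have /colP/(_ j) := ai0; rewrite !mxE => ->; rewrite mulr0.
split=> [Hfin y yF i|lam_fin].
  apply/lambda_bar_lty; apply: contrapT => nQ.
  have [Sy _] := fundamental_hole_hole yF.
  (* The map sending [k] to [y + k a_i] is injective as [a_i] is nonzero, and all its values are
     holes, so finitely many holes would make [nat] finite. *)
  apply: infinite_nat; apply: (@sub_finite_set _ _
    ((fun k : nat => y + col i A *+ k) @^-1` holes R A)).
    move=> k _; split; first exact/saturationD/semigroup_saturation/semigroupMn.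
    by move=> Qk; apply: nQ; exists k.
  apply: finite_preimage Hfin => k l _ _ /addrI kl.
  have [j aij] : exists j, col i A j 0 != 0.
    apply: contrapT => na; move/eqP: (a_neq0 i); apply; apply/colP => j.
    by rewrite [RHS]mxE; apply: contrapT => /eqP aj; apply: na; exists j.
  move/colP/(_ j): kl; rewrite !mulmxnE; exact: mulrIn.
have [M MQ] : exists M : 'cV[int]_d -> 'I_n -> nat, forall y i,
    fundamental_holes R A y -> semigroup A (y + col i A *+ M y i).
  have /choice[M MQ] : forall yi : 'cV[int]_d * 'I_n, exists k : nat,
      fundamental_holes R A yi.1 -> semigroup A (yi.1 + col yi.2 A *+ k).
    move=> [y i]; have [yF|nyF] := pselect (fundamental_holes R A y).
      by have /lambda_bar_lty[k Qk] := lam_fin y yF i; exists k.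
    by exists 0%N.
  by exists (fun y i => M (y, i)) => y i; exact: (MQ (y, i)).
(* A single bound per [y] lets [f y] run over a finite function type. *)
pose N y := \max_i M y i.
pose f y (g : {ffun 'I_n -> 'I_(N y).+1}) := y + \sum_i col i A *+ g i.
apply: (@sub_finite_set _ _ (\bigcup_(y in fundamental_holes R A) range (f y))).
  move=> h hH; have [y [yF [x hx]]] := hole_decomposition c_gt0 hH.
  exists y => //.
  have xM i : (x i < (N y).+1)%N.
    rewrite ltnS; apply: leq_trans (leq_bigmax i).
    (* If [M y i < x i], then [h] splits as [y + M y i a_i], plus [x i - M y i] copies of [a_i],
       plus the other columns, all in the semigroup. *)
    rewrite leqNgt; apply/negP => Mx; have [_] := hH; apply.
    rewrite -(subrK y h) hx addrC (bigD1 i) //= addrA.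
    rewrite -(subnKC (ltnW Mx)) mulrnDr addrA -addrA.
    apply: semigroupD; first exact: MQ.
    apply: semigroupD; first exact: semigroupMn.
    exists (fun k => if k == i then 0%N else x k).
    rewrite [RHS](bigD1 i) //= eqxx mulr0n add0r.
    by apply: eq_bigr => k /negPf ->.
  exists [ffun i => Ordinal (xM i)] => //.
  rewrite /f; under eq_bigr do rewrite ffunE.
  by rewrite /= -hx addrC subrK.
apply: bigcup_finite; first exact: finite_fundamental_holes.
by move=> y _; exact: finite_image.
Qed.
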